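(* A De Morgan function lies in (i) $\langle \mathsf{DMA}, \Delta\rangle$ iff it preserves $\mathrm{B}_2$, $\mathrm{K}_3$ and $\mathrm{P}_3$; (ii) $\langle \mathsf{DMA}, \Delta, \mathsf n\rangle$ iff it preserves $\mathrm{K}_3$; (iii) $\langle \mathsf{DMA}, \Delta, \mathsf b\rangle$ iff it preserves $\mathrm{P}_3$; (iv) $\langle \mathsf{DMA}, \Delta, \partial\rangle$ iff it preserves $\mathrm{B}_2$; (v) $\langle \mathsf{DMA}, \Delta, \mathrm{id}_{\mathsf b\mapsto\mathsf n}\rangle$ iff it preserves $\mathrm{B}_2$ and $\mathrm{K}_3$; (vi) $\langle \mathsf{DMA}, \Delta, \mathrm{id}_{\mathsf n\mapsto\mathsf b}\rangle$ iff it preserves $\mathrm{B}_2$ and $\mathrm{P}_3$.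
   Context: Let $\mathrm{DM}_4=\{\mathsf t,\mathsf f,\mathsf n,\mathsf b\}$. The truth order $\le$ has $\mathsf f$ least, $\mathsf t$ greatest, $\mathsf n,\mathsf b$ incomparable; $\wedge,\vee$ are its meet and join. De Morgan negation: $-\mathsf t=\mathsf f$, $-\mathsf f=\mathsf t$, $-\mathsf n=\mathsf n$, $-\mathsf b=\mathsf b$. Conflation: $\partial\mathsf t=\mathsf t$, $\partial\mathsf f=\mathsf f$, $\partial\mathsf n=\mathsf b$, $\partial\mathsf b=\mathsf n$. $\Delta a=\mathsf t$ if $a\in\{\mathsf t,\mathsf b\}$ and $\Delta a=\mathsf f$ otherwise. $\mathrm{id}_{\mathsf b\mapsto\mathsf n}$ maps $\mathsf b$ to $\mathsf n$ and fixes the other elements; $\mathrm{id}_{\mathsf n\mapsto\mathsf b}$ maps $\mathsf n$ to $\mathsf b$ and fixes the other elements. A De Morgan function is a map $\mathrm{DM}_4^n\to\mathrm{DM}_4$, $n\ge1$; a clone is a set of such functions closed under composition and containing all projections; constants are unary constant functions. $\langle\mathsf C,f_1,\dots\rangle$ is the clone generated by $\mathsf C\cup\{f_1,\dots\}$; $\mathsf{DMA}=\langle\wedge,\vee,\mathsf t,\mathsf f,-\rangle$. $f$ preserves $X\subseteq\mathrm{DM}_4$ if arguments in $X$ give values in $X$. $\mathrm{B}_2=\{\mathsf t,\mathsf f\}$, $\mathrm{K}_3=\{\mathsf t,\mathsf n,\mathsf f\}$, $\mathrm{P}_3=\{\mathsf t,\mathsf b,\mathsf f\}$. *)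

(* Defs.v *)
From HB Require Import structures.
From mathcomp Require Import all_boot all_order.
From mathcomp Require Import classical_sets.

Set Implicit Arguments.
Unset Strict Implicit.
Unset Printing Implicit Defensive.

Local Open Scope classical_set_scope.

Inductive DM4 : Type := DMt | DMf | DMn | DMb.

(* The pair records whether a value is at least true, resp. at least false;
   it only serves to transport the [finType] structure. *)
Definition DM4_code (x : DM4) : bool * bool :=
  match x with
  | DMt => (true, false)
  | DMf => (false, true)
  | DMn => (false, false)
  | DMb => (true, true)
  end.

Definition DM4_decode (p : bool * bool) : DM4 :=
  match p with
  | (true, false) => DMt
  | (false, true) => DMf
  | (false, false) => DMn
  | (true, true) => DMb
  end.

Lemma DM4_codeK : cancel DM4_code DM4_decode.
Proof. by case. Qed.

HB.instance Definition _ := Finite.copy DM4 (can_type DM4_codeK).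

(* Truth order: [DMf] least, [DMt] greatest, [DMn] and [DMb] incomparable. *)
Definition DM4_le (x y : DM4) : bool := [|| x == DMf, y == DMt | x == y].

Lemma DM4_le_refl : reflexive DM4_le.
Proof. by case. Qed.

Lemma DM4_le_anti : antisymmetric DM4_le.
Proof. by do 2![case]. Qed.

Lemma DM4_le_trans : transitive DM4_le.
Proof. by do 3![case]. Qed.

Fact DM4_display : Order.disp_t. Proof. exact: Order.Disp tt tt. Qed.

HB.instance Definition _ :=
  Order.Le_isPOrder.Build DM4_display DM4
    DM4_le_refl DM4_le_anti DM4_le_trans.

Lemma DM4_le0x (x : DM4) : (DMf <= x)%O.
Proof. by case: x. Qed.

Lemma DM4_lex1 (x : DM4) : (x <= DMt)%O.
Proof. by case: x. Qed.

HB.instance Definition _ :=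
  Order.hasBottom.Build DM4_display DM4 DM4_le0x.
HB.instance Definition _ :=
  Order.hasTop.Build DM4_display DM4 DM4_lex1.

(* Two distinct incomparable elements are necessarily [DMn] and [DMb]. *)
Definition DM4_meet (x y : DM4) : DM4 :=
  if DM4_le x y then x else if DM4_le y x then y else DMf.

Definition DM4_join (x y : DM4) : DM4 :=
  if DM4_le x y then y else if DM4_le y x then x else DMt.

Lemma DM4_meetP (x y z : DM4) :
  (x <= DM4_meet y z)%O = (x <= y)%O && (x <= z)%O.
Proof. by case: x; case: y; case: z. Qed.

Lemma DM4_joinP (x y z : DM4) :
  (DM4_join x y <= z)%O = (x <= z)%O && (y <= z)%O.
Proof. by case: x; case: y; case: z. Qed.

HB.instance Definition _ :=
  Order.POrder_MeetJoin_isLattice.Build DM4_display DM4 DM4_meetP DM4_joinP.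

Definition neg (x : DM4) : DM4 :=
  match x with DMt => DMf | DMf => DMt | DMn => DMn | DMb => DMb end.

Definition conflation (x : DM4) : DM4 :=
  match x with DMt => DMt | DMf => DMf | DMn => DMb | DMb => DMn end.

Definition Delta (x : DM4) : DM4 :=
  match x with DMt | DMb => DMt | DMf | DMn => DMf end.

Definition id_b_to_n (x : DM4) : DM4 := if x is DMb then DMn else x.

Definition id_n_to_b (x : DM4) : DM4 := if x is DMn then DMb else x.

(* De Morgan functions of all arities; nullary ones are excluded, so the arity
   is [(predArity f).+1]. *)
Record DMfun : Type := MkDMfun {
  predArity : nat;
  DMfun_val :> predArity.+1.-tuple DM4 -> DM4
}.

Definition unary (h : DM4 -> DM4) : DMfun :=
  @MkDMfun 0 (fun x => h (tnth x ord0)).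

Definition binary (h : DM4 -> DM4 -> DM4) : DMfun :=
  @MkDMfun 1 (fun x => h (tnth x ord0) (tnth x ord_max)).

Definition const_fun (a : DM4) : DMfun := unary (fun=> a).

Definition projection (n : nat) (i : 'I_n.+1) : DMfun :=
  MkDMfun (fun x : n.+1.-tuple DM4 => tnth x i).

Definition composition (m n : nat) (f : m.+1.-tuple DM4 -> DM4)
    (g : 'I_m.+1 -> n.+1.-tuple DM4 -> DM4) : DMfun :=
  MkDMfun (fun x : n.+1.-tuple DM4 => f [tuple g i x | i < m.+1]).

Definition is_clone (C : set DMfun) : Prop :=
  (forall (n : nat) (i : 'I_n.+1), C (projection i)) /\
  (forall (m n : nat) (f : m.+1.-tuple DM4 -> DM4)
          (g : 'I_m.+1 -> n.+1.-tuple DM4 -> DM4),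
      C (MkDMfun f) -> (forall i, C (MkDMfun (g i))) ->
      C (composition f g)).

Definition clone_gen (G : set DMfun) : set DMfun := smallest is_clone G.

Definition DMA : set DMfun :=
  clone_gen [set binary Order.meet; binary Order.join;
                 const_fun DMt; const_fun DMf; unary neg].

Definition preserves (f : DMfun) (X : set DM4) : Prop :=
  forall x : (predArity f).+1.-tuple DM4,
    (forall i, X (tnth x i)) -> X (f x).

Definition B2 : set DM4 := [set DMt; DMf].
Definition K3 : set DM4 := [set DMt; DMn; DMf].
Definition P3 : set DM4 := [set DMt; DMb; DMf].

(* Main.v *)
Require Import Defs.
From mathcomp Require Import all_boot all_order.
From mathcomp Require Import boolp classical_sets.

Import Order.LTheory.

Local Open Scope classical_set_scope.

(** De Morgan operations together with [Delta] define the indicator of every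
    point of [DM4 ^ n], so a function lies in a clone containing them as soon as,
    at each single point, it agrees with some member of the clone. A preserved
    subalgebra guarantees that a point where the value is [DMn] or [DMb] has
    a coordinate from which a unary member of the clone produces that value. *)

(** * Clones and the subsets they preserve *)

Lemma clone_gen_is_clone (G : set DMfun) : is_clone (clone_gen G).
Proof.
split=> [n i A [[Aproj _] _] | m n f g Gf Gg A AG]; first exact: Aproj.
have [[_ Acomp] _] := AG.
by apply: Acomp => [|i]; [apply: Gf | apply: Gg].
Qed.

Lemma preserves_is_clone (X : set DM4) : is_clone [set f | preserves f X].
Proof.
split=> [n i x Xx | m n f g Xf Xg x Xx] /=; first exact: Xx.
by apply: Xf => i; rewrite tnth_mktuple; apply: Xg.
Qed.

(** The functions preserving [X] form a clone, so it contains the smallest clone over [G] once it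
    contains [G]. This reduces every preservation claim to the generators. *)
Lemma clone_gen_preserves (G : set DMfun) (X : set DM4) (f : DMfun) :
  (forall g, G g -> preserves g X) -> clone_gen G f -> preserves f X.
Proof.
move=> GX; apply: (@smallest_sub _ is_clone _ [set g | preserves g X]) => //.
exact: preserves_is_clone.
Qed.

Lemma preserves_unary (h : DM4 -> DM4) (X : set DM4) :
  (forall x, X x -> X (h x)) -> preserves (unary h) X.
Proof. by move=> Xh x Xx; apply: Xh; apply: Xx. Qed.

Lemma preserves_binary (h : DM4 -> DM4 -> DM4) (X : set DM4) :
  (forall x y, X x -> X y -> X (h x y)) -> preserves (binary h) X.
Proof. by move=> Xh x Xx; apply: Xh; apply: Xx. Qed.

Lemma DMA_preserves (X : set DM4) (f : DMfun) :
  X DMt -> X DMf -> (forall x, X x -> X (neg x)) -> DMA f -> preserves f X.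
Proof.
move=> Xt Xf Xneg; apply: clone_gen_preserves => g.
(* No closure of [X] under meet and join is needed: the only incomparable
   elements, [DMn] and [DMb], have meet [DMf] and join [DMt]. *)
move=> [[[[->|->]|->]|->]|->].
- by apply: preserves_binary; do 2![case].
- by apply: preserves_binary; do 2![case].
- exact: preserves_unary.
- exact: preserves_unary.
- exact: preserves_unary.
Qed.

Lemma B2_neg (x : DM4) : B2 x -> B2 (neg x).
Proof. by case=> ->; [right | left]. Qed.

Lemma K3_neg (x : DM4) : K3 x -> K3 (neg x).
Proof. by case=> [[]|] ->; [right | left; right | left; left]. Qed.

Lemma P3_neg (x : DM4) : P3 x -> P3 (neg x).
Proof. by case=> [[]|] ->; [right | left; right | left; left]. Qed.

Lemma DMA_preserves_B2 (f : DMfun) : DMA f -> preserves f B2.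
Proof. by apply: DMA_preserves; [left | right | exact: B2_neg]. Qed.

Lemma DMA_preserves_K3 (f : DMfun) : DMA f -> preserves f K3.
Proof. by apply: DMA_preserves; [left; left | right | exact: K3_neg]. Qed.

Lemma DMA_preserves_P3 (f : DMfun) : DMA f -> preserves f P3.
Proof. by apply: DMA_preserves; [left; left | right | exact: P3_neg]. Qed.

Lemma B2_Delta (x : DM4) : B2 (Delta x).
Proof. by case: x; [left | right | right | left]. Qed.

Lemma B2_K3 : B2 `<=` K3.
Proof. by move=> x [] ->; [left; left | right]. Qed.

Lemma B2_P3 : B2 `<=` P3.
Proof. by move=> x [] ->; [left; left | right]. Qed.

Lemma Delta_preserves (X : set DM4) :
  B2 `<=` X -> preserves (unary Delta) X.
Proof. by move=> BX; apply: preserves_unary => x _; apply/BX/B2_Delta. Qed.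

Lemma notB2 (x : DM4) : ~ B2 x -> x = DMn \/ x = DMb.
Proof.
by case: x => [[]|[]| |]; [left | right | left | right].
Qed.

Lemma notK3 (x : DM4) : ~ K3 x -> x = DMb.
Proof. by case: x => // -[]; [left; left | right | left; right]. Qed.

Lemma notP3 (x : DM4) : ~ P3 x -> x = DMn.
Proof. by case: x => // -[]; [left; left | right | left; right]. Qed.

(** Contrapositive of preservation: a value outside [X] is traced back to a coordinate outside [X],
    to which a unary function can then be applied. *)
Lemma preservesN (f : DMfun) (X : set DM4) a :
  preserves f X -> ~ X (f a) -> exists i, ~ X (tnth a i).
Proof.
move=> fX fa; apply: contrapT => /forallNP aX.
by apply/fa/fX => i; apply: contrapT.
Qed.

(** [Delta x] tests whether [x] is at least true and [Delta (neg x)] whether it is at least false.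
    The meet checks both bits of [x] against the code of [c]. *)
Definition indicator (c x : DM4) : DM4 :=
  let p := DM4_code c in
  Order.meet (if p.1 then Delta x else neg (Delta x))
             (if p.2 then Delta (neg x) else neg (Delta (neg x))).

Lemma indicatorE (c x : DM4) : indicator c x = if c == x then DMt else DMf.
Proof. by case: c; case: x. Qed.

(** * Pointwise interpolation in a clone containing [DMA] and [Delta] *)

Section Interpolation.

Variable C : set DMfun.
Hypothesis C_clone : is_clone C.
Hypothesis C_DMA : DMA `<=` C.
Hypothesis C_Delta : C (unary Delta).

(** [unary id] is convertible to the projection of arity one. *)
Lemma clone_id : C (unary id).
Proof. exact: C_clone.1 0 ord0. Qed.

Lemma clone_ext n (g k : n.+1.-tuple DM4 -> DM4) :
  C (MkDMfun g) -> g =1 k -> C (MkDMfun k).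
Proof. by move=> Cg /funext <-. Qed.

Lemma clone_unary n (h : DM4 -> DM4) (g : n.+1.-tuple DM4 -> DM4) :
  C (unary h) -> C (MkDMfun g) -> C (MkDMfun (fun x => h (g x))).
Proof.
move=> Ch Cg; have := C_clone.2 _ _ _ (fun=> g) Ch (fun=> Cg).
by move/clone_ext; apply=> x; rewrite tnth_mktuple.
Qed.

Lemma clone_binary n (h : DM4 -> DM4 -> DM4) (g k : n.+1.-tuple DM4 -> DM4) :
  C (binary h) -> C (MkDMfun g) -> C (MkDMfun k) ->
  C (MkDMfun (fun x => h (g x) (k x))).
Proof.
move=> Ch Cg Ck.
(* The two arguments are packed as a family over ['I_2], as [composition] expects. *)
have Cgk (i : 'I_2) : C (MkDMfun (if i == ord0 then g else k)) by case: ifP.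
have := C_clone.2 _ _ _ _ Ch Cgk.
by move/clone_ext; apply=> x; rewrite !tnth_mktuple.
Qed.

Let DMA_gen g : [set binary Order.meet; binary Order.join;
  const_fun DMt; const_fun DMf; unary neg] g -> C g.
Proof. by move=> Gg; apply: C_DMA; apply: sub_gen_smallest Gg. Qed.

Lemma clone_meet : C (binary Order.meet).
Proof. by apply: DMA_gen; left; left; left; left. Qed.

Lemma clone_join : C (binary Order.join).
Proof. by apply: DMA_gen; left; left; left; right. Qed.

(** Written with [Order.top], convertible to [DMt], so that iterated meets have the unit of the
    monoid law as their default value; likewise for [Order.bottom] and joins. *)
Lemma clone_top : C (const_fun Order.top).
Proof. by apply: DMA_gen; left; left; right. Qed.

Lemma clone_bottom : C (const_fun Order.bottom).
Proof. by apply: DMA_gen; left; right. Qed.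

Lemma clone_neg : C (unary neg).
Proof. by apply: DMA_gen; right. Qed.

Lemma clone_const n (c : DM4) :
  C (const_fun c) -> C (MkDMfun (fun _ : n.+1.-tuple DM4 => c)).
Proof. by move/clone_unary; apply; apply: (C_clone.1 n ord0). Qed.

Lemma clone_big n (I : finType) (op : DM4 -> DM4 -> DM4) (idx : DM4)
    (g : I -> n.+1.-tuple DM4 -> DM4) :
  C (binary op) -> C (const_fun idx) -> (forall i, C (MkDMfun (g i))) ->
  C (MkDMfun (fun x => \big[op/idx]_i g i x)).
Proof.
move=> Cop Cidx Cg; elim: (index_enum I) => [|i r IHr].
  have := clone_const n _ Cidx.
  by move/clone_ext; apply=> x; rewrite big_nil.
have := clone_binary n op _ _ Cop (Cg i) IHr.
by move/clone_ext; apply=> x; rewrite big_cons.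
Qed.

Lemma clone_indicator n (c : DM4) (g : n.+1.-tuple DM4 -> DM4) :
  C (MkDMfun g) -> C (MkDMfun (fun x => indicator c (g x))).
Proof.
move=> Cg; have Cneg k := clone_unary n neg k clone_neg.
have CDelta k := clone_unary n Delta k C_Delta.
rewrite /indicator; apply: (clone_binary _ _ _ _ clone_meet);
  case: c => /=; auto.
Qed.

(** The indicator of [a] is the meet, over all coordinates, of the indicators of the entries of
    [a]. *)
Lemma clone_point_indicator n (a : n.+1.-tuple DM4) :
  C (MkDMfun (fun x => if x == a then DMt else DMf)).
Proof.
have := clone_big n _ _ _ _ clone_meet clone_top
  (fun i => clone_indicator n (tnth a i) _ (C_clone.1 n i)).
move/clone_ext; apply=> x.
have [->|xa] := eqVneq x a.
  by apply: big1 => i _; rewrite indicatorE eqxx.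
(* At a coordinate where [x] and [a] differ the factor is [DMf], which absorbs the whole meet. *)
have [i ai] : exists i, tnth a i != tnth x i.
  apply/existsP; apply: contraNT xa => /existsPn ax; apply/eqP/eq_from_tnth => i.
  by apply/esym/eqP/negPn/ax.
by rewrite (bigD1 i) //= indicatorE (negPf ai) meet0x.
Qed.

(** Disjunctive normal form: [f] is the join over all points [a] of the indicator of [a] met with a
    member of [C] agreeing with [f] at [a]. At [x] only the term of [x] survives. *)
Lemma clone_interpolation n (f : n.+1.-tuple DM4 -> DM4) :
  (forall a, exists2 g, C (MkDMfun g) & g a = f a) -> C (MkDMfun f).
Proof.
move=> /fin_all_exists2[g Cg gf].
have := clone_big n _ _ _ _ clone_join clone_bottom (fun a =>
  clone_binary n _ _ _ clone_meet (clone_point_indicator n a) (Cg a)).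
move/clone_ext; apply=> x.
rewrite (bigD1 x) //= eqxx gf meet1x big1 ?joinx0 //.
by move=> a ax; rewrite eq_sym (negPf ax) meet0x.
Qed.

(** Where [f] takes a classical value, a constant from [DMA] interpolates it; only the values [DMn]
    and [DMb] impose a condition. *)
Lemma clone_unary_interpolation (f : DMfun) :
  (forall a, f a = DMn -> exists h i, C (unary h) /\ h (tnth a i) = DMn) ->
  (forall a, f a = DMb -> exists h i, C (unary h) /\ h (tnth a i) = DMb) ->
  C f.
Proof.
case: f => n f /= fn fb; apply: clone_interpolation => a.
suff [h [i [Ch hf]]] : exists h i, C (unary h) /\ h (tnth a i) = f a.
  exists (fun x => h (tnth x i)) => //.
  by apply: clone_unary Ch _; apply: C_clone.1.
case fa: (f a); [| | exact: fn | exact: fb].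
- by exists (fun=> DMt), ord0; split=> //; apply: clone_top.
- by exists (fun=> DMf), ord0; split=> //; apply: clone_bottom.
Qed.

(** Since [DMn] is the only element outside [P3], some coordinate already equals it, and the
    identity suffices. *)
Lemma preserves_P3_value_n (f : DMfun) a : preserves f P3 -> f a = DMn ->
  exists h i, C (unary h) /\ h (tnth a i) = DMn.
Proof.
move=> fP fa; have [|i /notP3 ai] := preservesN f P3 a fP.
  by rewrite fa => -[[]|].
by exists id, i; split; first exact: clone_id.
Qed.

Lemma preserves_K3_value_b (f : DMfun) a : preserves f K3 -> f a = DMb ->
  exists h i, C (unary h) /\ h (tnth a i) = DMb.
Proof.
move=> fK fa; have [|i /notK3 ai] := preservesN f K3 a fK.
  by rewrite fa => -[[]|].
by exists id, i; split; first exact: clone_id.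
Qed.

(** Preservation of [B2] yields a coordinate that is [DMn] or [DMb] without deciding which, so both
    must be sent to [c] by unary members of [C]. *)
Lemma preserves_B2_value (f : DMfun) a c : preserves f B2 -> ~ B2 c -> f a = c ->
  (forall x, x = DMn \/ x = DMb -> exists2 h, C (unary h) & h x = c) ->
  exists h i, C (unary h) /\ h (tnth a i) = c.
Proof.
move=> fB Bc fa Cc; have [|i /notB2/Cc[h Ch hc]] := preservesN f B2 a fB.
  by rewrite fa.
by exists h, i.
Qed.

End Interpolation.

(** * The six extensions of [DMA] *)

Lemma clone_gen_extension (S : set DMfun) : S (unary Delta) ->
  [/\ is_clone (clone_gen (DMA `|` S)), DMA `<=` clone_gen (DMA `|` S),
      clone_gen (DMA `|` S) (unary Delta) & S `<=` clone_gen (DMA `|` S)].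
Proof.
move=> SD; have sub := @sub_gen_smallest _ is_clone (DMA `|` S).
split; [exact: clone_gen_is_clone| | |].
- by move=> g Dg; apply: sub; left.
- by apply: sub; right.
- by move=> g Sg; apply: sub; right.
Qed.

Theorem mainTheorem5 (f : DMfun) :
  (clone_gen (DMA `|` [set unary Delta]) f <->
     preserves f B2 /\ preserves f K3 /\ preserves f P3) /\
  (clone_gen (DMA `|` [set unary Delta; const_fun DMn]) f <->
     preserves f K3) /\
  (clone_gen (DMA `|` [set unary Delta; const_fun DMb]) f <->
     preserves f P3) /\
  (clone_gen (DMA `|` [set unary Delta; unary conflation]) f <->
     preserves f B2) /\
  (clone_gen (DMA `|` [set unary Delta; unary id_b_to_n]) f <->
     preserves f B2 /\ preserves f K3) /\
  (clone_gen (DMA `|` [set unary Delta; unary id_n_to_b]) f <->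
     preserves f B2 /\ preserves f P3).
Proof.
have BB : B2 `<=` B2 by [].
have DB := Delta_preserves _ BB.
have DK := Delta_preserves _ B2_K3.
have DP := Delta_preserves _ B2_P3.
have [MB MK] := (DMA_preserves_B2, DMA_preserves_K3).
have MP := DMA_preserves_P3.
have nB : ~ B2 DMn by case.
have bB : ~ B2 DMb by case.
split; last split; last split; last split; last split; split.
- move=> Cf; split; [|split]; apply: clone_gen_preserves Cf => g [|->] //;
  [exact: MB | exact: MK | exact: MP].
- move=> [fB [fK fP]].
  have [//|Cc CM CD _] := clone_gen_extension [set unary Delta].
  apply: clone_unary_interpolation => // a fa.
    exact: preserves_P3_value_n fP fa.
  exact: preserves_K3_value_b fK fa.
- apply: clone_gen_preserves => g [/MK|[->|->]] //.
  by apply: preserves_unary => x _; left; right.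
- move=> fK; have [|Cc CM CD CS] :=
    clone_gen_extension [set unary Delta; const_fun DMn]; first by left.
  apply: clone_unary_interpolation => // a fa.
    (* The added constant supplies the value [DMn] at every point. *)
    by exists (fun=> DMn), ord0; split=> //; apply: CS; right.
  exact: preserves_K3_value_b fK fa.
- apply: clone_gen_preserves => g [/MP|[->|->]] //.
  by apply: preserves_unary => x _; left; right.
- move=> fP; have [|Cc CM CD CS] :=
    clone_gen_extension [set unary Delta; const_fun DMb]; first by left.
  apply: clone_unary_interpolation => // a fa.
    exact: preserves_P3_value_n fP fa.
  by exists (fun=> DMb), ord0; split=> //; apply: CS; right.
- apply: clone_gen_preserves => g [/MB|[->|->]] //.
  by apply: preserves_unary => x [] ->; [left | right].
- move=> fB; have [|Cc CM CD CS] :=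
    clone_gen_extension [set unary Delta; unary conflation]; first by left.
  have Ci := clone_id _ Cc.
  have Cs : clone_gen (DMA `|` [set unary Delta; unary conflation])
    (unary conflation) by apply: CS; right.
  (* Conflation swaps [DMn] and [DMb], so together with the identity it reaches either value from
     either coordinate. *)
  apply: clone_unary_interpolation => // a fa; apply: preserves_B2_value fa _ => //.
    by move=> x [] ->; [exists id | exists conflation].
  by move=> x [] ->; [exists conflation | exists id].
- move=> Cf; split; apply: clone_gen_preserves Cf => g.
    move=> [/MB|[->|->]] //.
    by apply: preserves_unary => x [] ->; [left | right].
  move=> [/MK|[->|->]] //; apply: preserves_unary => x [[]|] ->;
  by [left; left | left; right | right].
- move=> [fB fK]; have [|Cc CM CD CS] :=
    clone_gen_extension [set unary Delta; unary id_b_to_n]; first by left.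
  apply: clone_unary_interpolation => // a fa.
    apply: preserves_B2_value fa _ => // x xnb.
    (* A single function works here, as [id_b_to_n] sends both nonclassical elements to [DMn]. *)
    by exists id_b_to_n; [apply: CS; right | case: xnb => ->].
  exact: preserves_K3_value_b fK fa.
- move=> Cf; split; apply: clone_gen_preserves Cf => g.
    move=> [/MB|[->|->]] //.
    by apply: preserves_unary => x [] ->; [left | right].
  move=> [/MP|[->|->]] //; apply: preserves_unary => x [[]|] ->;
  by [left; left | left; right | right].
- move=> [fB fP]; have [|Cc CM CD CS] :=
    clone_gen_extension [set unary Delta; unary id_n_to_b]; first by left.
  apply: clone_unary_interpolation => // a fa.
    exact: preserves_P3_value_n fP fa.
  apply: preserves_B2_value fa _ => // x xnb.
  by exists id_n_to_b; [apply: CS; right | case: xnb => ->].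
Qed.
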